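(* Let $Q_1\subset\mathbb{R}^{n_1}$ and $Q_2\subset\mathbb{R}^{n_2}$ be nonempty convex compact sets, $Q=Q_1\times Q_2$, and let $f:\mathbb{R}^{n_1+n_2}\to\mathbb{R}$, $f=f(u,v)$, be convex in $u\in Q_1$ and concave in $v\in Q_2$. Consider the saddle point problem of finding $(u_*,v_* )\in Q$ with $f(u_*,v)\le f(u_*,v_* )\le f(u,v_* )$ for all $u\in Q_1$, $v\in Q_2$. Let $L>0$, $\delta>0$, $\tilde\delta\ge0$, $\varepsilon>0$, and suppose that this saddle point problem admits a $(\delta,L)$-model $\psi(x,y)$ (as defined in the context). Run the adaptive method described in the context on $\psi$ with accuracy $\varepsilon$, inexactness $\tilde\delta$ in the auxiliary problems, $x^0=\arg\min_{x\in Q}d(x)$ and $0<L^0\le 2L$, and suppose it has stopped after $N\ge 1$ iterations. Then the point $$\tilde y=(\tilde u,\tilde v):=\frac{1}{S_N}\sum_{k=0}^{N-1}\frac{y^{k+1}}{L^{k+1}},\qquad S_N:=\sum_{k=0}^{N-1}\frac{1}{L^{k+1}},$$ satisfies $$\max_{v\in Q_2}f(\tilde u,v)-\min_{u\in Q_1}f(u,\tilde v)\le\varepsilon+2\tilde\delta+\delta.$$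
   Context: Notation: points of $Q$ are written $x=(u_x,v_x)$, $y=(u_y,v_y)$ with $u_x,u_y\in Q_1$, $v_x,v_y\in Q_2$. The norm is $\|x\|=\sqrt{\|u_x\|_1^2+\|v_x\|_2^2}$, where $\|\cdot\|_1$ and $\|\cdot\|_2$ are norms on $\mathbb{R}^{n_1}$ and $\mathbb{R}^{n_2}$. The function $d:Q\to\mathbb{R}$ is differentiable at all points of $Q$ and $1$-strongly convex with respect to $\|\cdot\|$, and $V(x,y)=d(x)-d(y)-\langle\nabla d(y),x-y\rangle$ is its Bregman divergence. The max and min in the conclusion are understood as supremum and infimum, i.e. the conclusion is $f(\tilde u,v)-f(u,\tilde v)\le\varepsilon+2\tilde\delta+\delta$ for all $u\in Q_1$, $v\in Q_2$. Definition. A function $\psi:\mathbb{R}^{n_1+n_2}\times\mathbb{R}^{n_1+n_2}\to\mathbb{R}$ is a $(\delta,L)$-model for the saddle point problem if for all $x,y,z\in Q$: (i) $\psi(x,y)$ is convex in the first variable; (ii) $\psi(x,x)=0$; (iii) $\psi(x,y)+\psi(y,x)\le 0$; (iv) $\psi(x,y)\le\psi(x,z)+\psi(z,y)+LV(x,z)+LV(z,y)+\delta$; (v) $f(u_y,v_x)-f(u_x,v_y)\le-\psi(x,y)$. Inexact minimization: for a convex function $\varphi:Q\to\mathbb{R}$ and $\tilde\delta\ge 0$, the notation $x=\arg\min^{\tilde\delta}_{y\in Q}\varphi(y)$ means that $x\in Q$ and, for some (sub)gradient $\nabla\varphi(x)$ of $\varphi$ at $x$ (i.e. a vector $p$ with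 $\varphi(y)\ge\varphi(x)+\langle p,y-x\rangle$ for all $y\in Q$), one has $\langle\nabla\varphi(x),x-y\rangle\le\tilde\delta$ for all $y\in Q$. The adaptive method. Start from $x^0=\arg\min_{x\in Q}d(x)$ and a constant $L^0>0$. The $(k+1)$-st iteration ($k=0,1,2,\dots$), given $x^k$ and $L^k$, is as follows. 1. Set $L^{k+1}:=L^k/2$. 2. Compute $$y^{k+1}:=\arg\min_{x\in Q}^{\tilde\delta}\{\psi(x,x^k)+L^{k+1}V(x,x^k)\},\qquad x^{k+1}:=\arg\min_{x\in Q}^{\tilde\delta}\{\psi(x,y^{k+1})+L^{k+1}V(x,x^k)\}.$$ 3. If the inequality $$\psi(x^{k+1},x^k)\le\psi(y^{k+1},x^k)+\psi(x^{k+1},y^{k+1})+L^{k+1}V(y^{k+1},x^k)+L^{k+1}V(x^{k+1},y^{k+1})+\delta$$ fails, replace $L^{k+1}$ by $2L^{k+1}$ and repeat step 2. Otherwise the iteration is complete with the current $L^{k+1},y^{k+1},x^{k+1}$. The method stops after $N$ iterations as soon as $\sum_{k=0}^{N-1}\frac{1}{L^{k+1}}\ge\frac{\max_{x\in Q}V(x,x^0)}{\varepsilon}$. All inexact minimizers in the sense above that are used by the method are taken to exist. *)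

(* Defs.v *)
From mathcomp Require Import all_boot all_order all_algebra.
From mathcomp Require Import all_classical all_reals all_analysis.

Set Implicit Arguments.
Unset Strict Implicit.
Unset Printing Implicit Defensive.

Import Order.TTheory GRing.Theory Num.Theory.
Import numFieldNormedType.Exports.

Local Open Scope classical_set_scope.
Local Open Scope ring_scope.

(* Points of R^(n1+n2) are pairs x = (u_x, v_x), with u_x = x.1, v_x = x.2. *)
Notation pointR R n1 n2 := ('rV[R]_n1 * 'rV[R]_n2)%type (only parsing).

Definition inner (R : realType) (n1 n2 : nat) (p x : pointR R n1 n2) : R :=
  \sum_(i < n1) p.1 ord0 i * x.1 ord0 i + \sum_(j < n2) p.2 ord0 j * x.2 ord0 j.

Record is_norm (R : realType) (n : nat) (N : 'rV[R]_n -> R) : Prop := IsNorm {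
  norm_triangle : forall x y, N (x + y) <= N x + N y;
  norm_scale : forall (a : R) x, N (a *: x) = `|a| * N x;
  norm_definite : forall x, N x = 0 -> x = 0
}.

Definition pnorm (R : realType) (n1 n2 : nat)
    (norm1 : 'rV[R]_n1 -> R) (norm2 : 'rV[R]_n2 -> R) (x : pointR R n1 n2) : R :=
  Num.sqrt (norm1 x.1 ^+ 2 + norm2 x.2 ^+ 2).

Definition strongly_convex (R : realType) (n1 n2 : nat) (mu : R)
    (N : pointR R n1 n2 -> R) (Q : set (pointR R n1 n2))
    (d : pointR R n1 n2 -> R) : Prop :=
  forall x y (t : R), Q x -> Q y -> 0 <= t <= 1 ->
    d (t *: x + (1 - t) *: y)
      <= t * d x + (1 - t) * d y - mu / 2 * t * (1 - t) * N (x - y) ^+ 2.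

(* p is a gradient at x of d, seen as a function on Q:
     d y = d x + <p, y - x> + o(|y - x|)   as y -> x in Q.
   Only the values of d on Q matter, so x may be a boundary point of Q and Q may
   have empty interior.  If Q is convex, <p, y - x> does not depend on the
   choice of p when y is in Q.  The norm |y - x| is the sup norm of R^(n1+n2);
   any other norm gives the same notion. *)
Definition is_gradient_on (R : realType) (n1 n2 : nat)
    (Q : set (pointR R n1 n2)) (d : pointR R n1 n2 -> R)
    (x p : pointR R n1 n2) : Prop :=
  forall e : R, 0 < e ->
    \forall y \near within Q (nbhs x),
      `|d y - d x - inner p (y - x)| <= e * `|y - x|.

Definition bregman (R : realType) (n1 n2 : nat) (d : pointR R n1 n2 -> R)
    (gradd : pointR R n1 n2 -> pointR R n1 n2) (x y : pointR R n1 n2) : R :=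
  d x - d y - inner (gradd y) (x - y).

Definition convex_concave (R : realType) (n1 n2 : nat)
    (Q1 : set 'rV[R]_n1) (Q2 : set 'rV[R]_n2)
    (f : 'rV[R]_n1 -> 'rV[R]_n2 -> R) : Prop :=
  (forall v, Q2 v -> convex_function Q1 (fun u => f u v)) /\
  (forall u, Q1 u -> convex_function Q2 (fun v => - f u v)).

Record saddle_model (R : realType) (n1 n2 : nat) (Q : set (pointR R n1 n2))
    (f : 'rV[R]_n1 -> 'rV[R]_n2 -> R)
    (V : pointR R n1 n2 -> pointR R n1 n2 -> R) (delta L : R)
    (psi : pointR R n1 n2 -> pointR R n1 n2 -> R) : Prop := SaddleModel {
  model_convex : forall y, Q y -> convex_function Q (fun x => psi x y);
  model_diag : forall x, Q x -> psi x x = 0;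
  model_monotone : forall x y, Q x -> Q y -> psi x y + psi y x <= 0;
  model_smooth : forall x y z, Q x -> Q y -> Q z ->
    psi x y <= psi x z + psi z y + L * V x z + L * V z y + delta;
  model_gap : forall x y, Q x -> Q y ->
    f y.1 x.2 - f x.1 y.2 <= - psi x y
}.

Definition is_argmin (R : realType) (n1 n2 : nat) (Q : set (pointR R n1 n2))
    (phi : pointR R n1 n2 -> R) (x : pointR R n1 n2) : Prop :=
  Q x /\ forall y, Q y -> phi x <= phi y.

Definition is_subgradient (R : realType) (n1 n2 : nat)
    (Q : set (pointR R n1 n2)) (phi : pointR R n1 n2 -> R)
    (x p : pointR R n1 n2) : Prop :=
  forall y, Q y -> phi x + inner p (y - x) <= phi y.

Definition is_inexact_argmin (R : realType) (n1 n2 : nat)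
    (Q : set (pointR R n1 n2)) (dt : R) (phi : pointR R n1 n2 -> R)
    (x : pointR R n1 n2) : Prop :=
  Q x /\ exists p, is_subgradient Q phi x p /\
    forall y, Q y -> inner p (x - y) <= dt.

(* Both prox terms are centred at xk; M is the trial value of L^(k+1). *)
Definition trial_points (R : realType) (n1 n2 : nat) (Q : set (pointR R n1 n2))
    (V psi : pointR R n1 n2 -> pointR R n1 n2 -> R) (dt : R)
    (xk : pointR R n1 n2) (M : R) (y x : pointR R n1 n2) : Prop :=
  is_inexact_argmin Q dt (fun z => psi z xk + M * V z xk) y /\
  is_inexact_argmin Q dt (fun z => psi z y + M * V z xk) x.

Definition acceptance_test (R : realType) (n1 n2 : nat)
    (V psi : pointR R n1 n2 -> pointR R n1 n2 -> R) (delta : R)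
    (xk : pointR R n1 n2) (M : R) (y x : pointR R n1 n2) : Prop :=
  psi x xk <= psi y xk + psi x y + M * V y xk + M * V x y + delta.

(* The inner loop: started from xk with the current trial constant M, it ends
   with the accepted constant M' and the accepted points y', x'. *)
Inductive backtracking (R : realType) (n1 n2 : nat) (Q : set (pointR R n1 n2))
    (V psi : pointR R n1 n2 -> pointR R n1 n2 -> R) (delta dt : R)
    (xk : pointR R n1 n2) :
    R -> R -> pointR R n1 n2 -> pointR R n1 n2 -> Prop :=
| backtracking_accept (M : R) (y x : pointR R n1 n2) :
    trial_points Q V psi dt xk M y x ->
    acceptance_test V psi delta xk M y x ->
    backtracking Q V psi delta dt xk M M y x
| backtracking_reject (M : R) (y x : pointR R n1 n2)
    (M' : R) (y' x' : pointR R n1 n2) :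
    trial_points Q V psi dt xk M y x ->
    ~ acceptance_test V psi delta xk M y x ->
    backtracking Q V psi delta dt xk (2 * M) M' y' x' ->
    backtracking Q V psi delta dt xk M M' y' x'.

(* S_n, where Ls k = L^k. *)
Definition weight_sum (R : realType) (Ls : nat -> R) (n : nat) : R :=
  \sum_(k < n) (Ls k.+1)^-1.

Definition stopping_criterion (R : realType) (n1 n2 : nat)
    (Q : set (pointR R n1 n2)) (V : pointR R n1 n2 -> pointR R n1 n2 -> R)
    (eps : R) (x0 : pointR R n1 n2) (Ls : nat -> R) (n : nat) : Prop :=
  sup [set V x x0 | x in Q] / eps <= weight_sum Ls n.

(* The adaptive method stops after exactly N iterations, producing Ls k = L^k,
   xs k = x^k and ys k = y^k; only the indices k <= N (k <> 0 for ys) matter.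
   The stopping criterion is tested at the end of each iteration. *)
Record adaptive_run (R : realType) (n1 n2 : nat) (Q : set (pointR R n1 n2))
    (d : pointR R n1 n2 -> R) (V psi : pointR R n1 n2 -> pointR R n1 n2 -> R)
    (delta dt eps L0 : R) (N : nat)
    (Ls : nat -> R) (xs ys : nat -> pointR R n1 n2) : Prop := AdaptiveRun {
  run_x0 : is_argmin Q d (xs 0%N);
  run_L0 : Ls 0%N = L0;
  run_step : forall k, (k < N)%N ->
    backtracking Q V psi delta dt (xs k)
      (Ls k / 2) (Ls k.+1) (ys k.+1) (xs k.+1);
  run_continue : forall n, (0 < n < N)%N ->
    ~ stopping_criterion Q V eps (xs 0%N) Ls n;
  run_stop : stopping_criterion Q V eps (xs 0%N) Ls N
}.

Definition weighted_average (R : realType) (n1 n2 : nat) (Ls : nat -> R)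
    (ys : nat -> pointR R n1 n2) (N : nat) : pointR R n1 n2 :=
  (weight_sum Ls N)^-1 *: \sum_(k < N) (Ls k.+1)^-1 *: ys k.+1.

(* Main.v *)
Require Import Defs.
From mathcomp Require Import all_boot all_order all_algebra.
From mathcomp Require Import all_classical all_reals all_analysis.
From mathcomp Require Import ring lra.

Set Implicit Arguments.
Unset Strict Implicit.
Unset Printing Implicit Defensive.

Import Order.TTheory GRing.Theory Num.Theory.
Import numFieldNormedType.Exports.

Local Open Scope classical_set_scope.
Local Open Scope ring_scope.

(** For an inexact minimiser [y] of [phi + M V(., z)] with [phi] convex, the first
    order condition along the segment from [y] to [x] and the three-point identity
    for the Bregman divergence give
      [phi y + M V(y, z) + M V(x, y) <= phi x + M V(x, z) + dt].
    Applying this to both auxiliary problems of an iteration and adding the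
    acceptance test bounds [- psi z y^(k+1)] by
      [L^(k+1) (V(z, x^k) - V(z, x^(k+1))) + 2 dt + delta].
    Dividing by [L^(k+1)] makes the divergences telescope; the gap at the average
    is then controlled by condition (v) of the model and Jensen's inequality.  *)

(** * Convex combinations and Jensen's inequality with unnormalized weights *)

Section Convexity.
Context {R : realType} {E : lmodType R}.
Implicit Types (Q : set E) (g : E -> R) (x y : E) (t : R).

Lemma convex_set_comb Q x y t :
  convex_set Q -> Q x -> Q y -> 0 <= t <= 1 -> Q (t *: x + (1 - t) *: y).
Proof.
move=> Qc Qx Qy /andP[t0 t1]; apply/set_mem.
exact: (Qc x y (Itv01 t0 t1) (mem_set Qx) (mem_set Qy)).
Qed.

Lemma convex_function_comb Q g x y t :
  convex_function Q g -> Q x -> Q y -> 0 <= t <= 1 ->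
  g (t *: x + (1 - t) *: y) <= t * g x + (1 - t) * g y.
Proof.
move=> gc Qx Qy /andP[t0 t1].
exact: (gc (Itv01 t0 t1) x y (mem_set Qx) (mem_set Qy)).
Qed.

(** Induction on [n]: the new mean is a two-point combination of the old mean and the new point,
    with [t] the old share of the total weight. Positivity of [W] and membership of [m] are carried
    along because this combination needs both. *)
Lemma jensen_weighted Q g (w : nat -> R) (p : nat -> E) n :
  convex_set Q -> convex_function Q g ->
  (forall k, (k <= n)%N -> 0 < w k /\ Q (p k)) ->
  let W := \sum_(k < n.+1) w k in
  let m := W^-1 *: \sum_(k < n.+1) w k *: p k in
  [/\ 0 < W, Q m & g m <= W^-1 * \sum_(k < n.+1) w k * g (p k)].
Proof.
move=> Qc gc; elim: n => [|n IH] wp /=.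
  have [w0 p0] := wp 0%N isT.
  rewrite !big_ord_recr !big_ord0 /= !add0r scalerA mulrA mulVf ?gt_eqF//.
  by rewrite scale1r mul1r; split.
have [k kn|/= W0 Qm gm] := IH; first by apply: wp; exact: leqW.
have [w0 Qp] := wp n.+1 (leqnn _).
rewrite big_ord_recr [X in _ *: X]big_ord_recr [X in _ <= _ * X]big_ord_recr /=.
move: gm Qm W0; set W := \sum_(i < n.+1) _; set P := \sum_(i < n.+1) _.
set G := \sum_(i < n.+1) _ => gm Qm W0.
have W1 : 0 < W + w n.+1 by rewrite addr_gt0.
pose t := W / (W + w n.+1).
have t01 : 0 <= t <= 1.
  apply/andP; split; first by rewrite divr_ge0 ?ltW.
  by rewrite ler_pdivrMr// mul1r lerDl ltW.
have t1E : 1 - t = w n.+1 / (W + w n.+1) by rewrite /t; field; rewrite gt_eqF.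
have -> : (W + w n.+1)^-1 *: (P + w n.+1 *: p n.+1) =
          t *: (W^-1 *: P) + (1 - t) *: p n.+1.
  rewrite scalerDr !scalerA t1E /t; congr (_ *: _ + _ *: _).
    by field; rewrite !gt_eqF.
  by rewrite mulrC.
split=> //; first exact: convex_set_comb.
apply: (le_trans (convex_function_comb gc Qm Qp t01)).
have -> : (W + w n.+1)^-1 * (G + w n.+1 * g (p n.+1)) =
          t * (W^-1 * G) + (1 - t) * g (p n.+1).
  by rewrite t1E /t; field; rewrite !gt_eqF.
by rewrite lerD2r ler_wpM2l//; case/andP: t01.
Qed.

End Convexity.

Lemma convex_setX {R : realType} {E F : lmodType R} (A : set E) (B : set F) :
  convex_set A -> convex_set B -> convex_set (A `*` B).
Proof.
move=> cA cB x y t /set_mem[Ax Bx] /set_mem[Ay By]; apply/mem_set; split.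
- exact/set_mem/(cA x.1 y.1 t (mem_set Ax) (mem_set Ay)).
- exact/set_mem/(cB x.2 y.2 t (mem_set Bx) (mem_set By)).
Qed.

(** * Bregman divergences and inexact proximal steps *)

Section Prox.
Context {R : realType} {n1 n2 : nat}.
Local Notation point := (pointR R n1 n2).
Implicit Types (Q : set point) (x y z p : point) (d phi : point -> R).

Lemma innerDr p x y : inner p (x + y) = inner p x + inner p y.
Proof.
rewrite /inner addrACA -!big_split /=.
by congr (_ + _); apply: eq_bigr => i _; rewrite mxE mulrDr.
Qed.

Lemma innerZr p (a : R) x : inner p (a *: x) = a * inner p x.
Proof.
rewrite /inner mulrDr !mulr_sumr.
by congr (_ + _); apply: eq_bigr => i _; rewrite mxE mulrCA.
Qed.

Lemma innerNr p x : inner p (- x) = - inner p x.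
Proof. by rewrite -scaleN1r innerZr mulN1r. Qed.

Lemma innerBr p x y : inner p (x - y) = inner p x - inner p y.
Proof. by rewrite innerDr innerNr. Qed.

Lemma inner0r p : inner p 0 = 0.
Proof. by rewrite -(scale0r (0 : point)) innerZr mul0r. Qed.

Lemma inner_continuous p : continuous (inner p : point -> R).
Proof.
move=> x; rewrite /inner; apply: cvgD; apply: cvg_big => //.
- exact: add_continuous.
- move=> i _; apply: cvgM; first exact: cvg_cst.
  apply: (@cvg_comp _ _ _ fst (fun u : 'rV[R]_n1 => u ord0 i) _ (nbhs x.1)).
    exact: cvg_fst.
  exact: coord_continuous.
- exact: add_continuous.
- move=> i _; apply: cvgM; first exact: cvg_cst.
  apply: (@cvg_comp _ _ _ snd (fun u : 'rV[R]_n2 => u ord0 i) _ (nbhs x.2)).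
    exact: cvg_snd.
  exact: coord_continuous.
Qed.

(** The increment of [d] is a first order remainder plus a linear term; near [x] each is at most
    [e / 2], the remainder because [|y - x| <= 1] there. *)
Lemma gradient_on_continuous Q d (gradd : point -> point) :
  (forall x, Q x -> is_gradient_on Q d x (gradd x)) ->
  {within Q, continuous d}.
Proof.
move=> dg; apply/subspace_continuousP => x Qx; apply/cvgrPdist_le => e e0.
have e2 : 0 < e / 2 by rewrite divr_gt0.
have near_inner : \forall y \near within Q (nbhs x),
    `|inner (gradd x) (y - x)| <= e / 2.
  apply: cvg_within.
  have /cvgrPdist_le/(_ _ e2) := @inner_continuous (gradd x) x.
  by apply: filterS => y; rewrite innerBr distrC.
have near_norm : \forall y \near within Q (nbhs x), `|y - x| <= 1.
  apply: cvg_within.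
  have /cvgrPdist_le/(_ _ ltr01) := @cvg_id _ (nbhs x).
  by apply: filterS => y; rewrite distrC.
move: (dg x Qx _ e2) near_inner near_norm.
apply: filterS3 => y /= H1 H2 H3.
rewrite distrC.
have -> : d y - d x =
    (d y - d x - inner (gradd x) (y - x)) + inner (gradd x) (y - x).
  by rewrite subrK.
apply: (le_trans (ler_normD _ _)); rewrite [leRHS](splitr e) lerD//.
by apply: (le_trans H1); rewrite ger_pMr.
Qed.

(** Boundedness makes the [sup] of the stopping criterion a genuine upper bound. It comes from
    continuity on a compact set. *)
Lemma bregman_bounded Q d (gradd : point -> point) z :
  compact Q -> (forall x, Q x -> is_gradient_on Q d x (gradd x)) ->
  has_ubound [set bregman d gradd x z | x in Q].
Proof.
move=> Qk dg.
have Vc : {within Q, continuous (fun x => bregman d gradd x z)}.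
  have dc := gradient_on_continuous dg.
  move=> x; rewrite /bregman; apply: cvgB.
    by apply: cvgB; [exact: dc | exact: cvg_cst].
  rewrite (_ : (fun y => inner _ _) =
               (fun y => inner (gradd z) y - inner (gradd z) z)); last first.
    by apply/funext => y; rewrite innerBr.
  rewrite innerBr; apply: cvgB; last exact: cvg_cst.
  exact: (continuous_subspaceT (@inner_continuous (gradd z))).
have [M [_ HM]] := compact_bounded (continuous_compact Vc Qk).
exists (M + 1) => _ [x Qx <-]; apply: (le_trans (ler_norm _)).
by apply: HM; [rewrite ltrDl | exists x].
Qed.

(* One [t] suffices, not all small ones: the functions compared along [x, y]
   are convex, so a single difference quotient yields the first order condition. *)
Lemma gradient_on_segment Q d x p y (e : R) :
  convex_set Q -> Q x -> Q y -> is_gradient_on Q d x p -> 0 < e ->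
  exists2 t, 0 < t <= 1 &
    `|d (t *: y + (1 - t) *: x) - d x - t * inner p (y - x)| <= t * e.
Proof.
(* The summand [1] keeps [c] positive when [y = x]. With precision [e / c], the remainder at
   distance [t * |y - x|] is at most [t * e]. *)
move=> Qc Qx Qy dg e0; pose c := 1 + `|y - x|.
have c0 : 0 < c by rewrite ltr_pwDl.
have /nbhs_normP[r /= r0 Hr] := dg (e / c) (divr_gt0 e0 c0).
(* The factor [2] puts the point at distance at most [r / 2], hence strictly inside the ball of
   radius [r]. *)
pose t := Num.min 1 (r / (2 * c)).
have t0 : 0 < t by rewrite lt_min ltr01 divr_gt0 ?mulr_gt0.
have t1 : t <= 1 by rewrite ge_min lexx.
have segE : t *: y + (1 - t) *: x - x = t *: (y - x).
  by rewrite scalerBl scale1r scalerBr addrCA addrAC subrr add0r addrC.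
exists t; first by rewrite t0.
have := Hr (t *: y + (1 - t) *: x).
rewrite segE innerZr normrZ (gtr0_norm t0).
have near_x : `|t *: (y - x)| < r.
  rewrite normrZ (gtr0_norm t0).
  apply: (@le_lt_trans _ _ (r / (2 * c) * c)).
    apply: ler_pM => //; first exact: ltW.
      by rewrite ge_min lexx orbT.
    by rewrite lerDr.
  rewrite invfM mulrA mulfVK ?gt_eqF//.
  by rewrite ltr_pdivrMr// mulr_natr mulr2n ltrDl.
move=> /= H; apply: (le_trans (H _ _)).
- by rewrite /= -normrN opprB segE.
- by apply: convex_set_comb; rewrite ?(ltW t0).
- rewrite mulrCA ler_wpM2l ?(ltW t0)//.
  by rewrite -mulrA ger_pMr// mulrC ler_pdivrMr// mul1r lerDr.
Qed.

(** Strong convexity bounds [d] on a short segment from above, the gradient bounds it from below up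
    to [t * e]. The quadratic term has the favourable sign; dividing by [t] leaves an arbitrary
    [e]. *)
Lemma bregman_ge0 Q d (gradd : point -> point) (N : point -> R) x y :
  convex_set Q -> strongly_convex 1 N Q d ->
  is_gradient_on Q d y (gradd y) -> Q x -> Q y -> 0 <= bregman d gradd x y.
Proof.
move=> Qc dsc dg Qx Qy; rewrite /bregman subr_ge0; apply/ler_addgt0Pr => e e0.
have [t /andP[t0 t1]] := gradient_on_segment Qc Qy Qx dg e0.
have t01 : 0 <= t <= 1 by rewrite ltW.
rewrite ler_norml => /andP[H _].
have := dsc _ _ _ Qx Qy t01.
have : 0 <= 1 / 2 * t * (1 - t) * N (x - y) ^+ 2.
  apply: mulr_ge0 (sqr_ge0 _).
  by rewrite !mulr_ge0 ?invr_ge0 ?subr_ge0 ?(ltW t0).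
move: H; set D := d (_ + _); set I := inner _ _; set S := 1 / 2 * _ * _ * _.
by move=> H S0 HS; rewrite -(ler_pM2l t0); nra.
Qed.

Lemma bregman_three_points d (gradd : point -> point) x y z :
  inner (gradd y) (x - y) - inner (gradd z) (x - y) =
  bregman d gradd x z - bregman d gradd x y - bregman d gradd y z.
Proof. by rewrite /bregman !innerBr; ring. Qed.

Lemma inexact_prox Q d (gradd : point -> point) (dt M : R) phi x y z :
  convex_set Q -> (forall x, Q x -> is_gradient_on Q d x (gradd x)) ->
  convex_function Q phi -> 0 < M ->
  is_inexact_argmin Q dt (fun w => phi w + M * bregman d gradd w z) y -> Q x ->
  phi y + M * bregman d gradd y z + M * bregman d gradd x y
    <= phi x + M * bregman d gradd x z + dt.
Proof.
move=> Qc dg phic M0 [Qy [p [psub pdt]]] Qx.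
(* By the three-point identity, the claim is a variational inequality in which only the Bregman term
   is linearized at [y]. *)
suff : - dt <= phi x - phi y
        + M * (inner (gradd y) (x - y) - inner (gradd z) (x - y)).
  rewrite (bregman_three_points d).
  by move: (bregman _ _ _ _) (bregman _ _ _ _) (bregman _ _ _ _) => *; lra.
apply/ler_addgt0Pr => e e0.
(* The vector [p] is a subgradient of the whole sum, so it is tested at a point of the segment,
   where [phi] is bounded by convexity and [d] by its expansion. Precision [e / M] becomes [e] after
   multiplication by [M]. *)
have [t /andP[t0 t1]] := gradient_on_segment Qc Qy Qx (dg _ Qy) (divr_gt0 e0 M0).
have t01 : 0 <= t <= 1 by rewrite ltW.
rewrite ler_norml => /andP[_ H].
have Qs := convex_set_comb Qc Qx Qy t01.
have := psub _ Qs; have := convex_function_comb phic Qx Qy t01.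
have := pdt _ Qx.
rewrite /bregman -opprB innerNr.
have segE w z' : inner w (t *: x + (1 - t) *: y - z') =
    inner w (y - z') + t * inner w (x - y).
  rewrite -innerZr -innerDr; congr inner.
  by rewrite scalerBl scale1r scalerBr addrCA addrAC.
rewrite !segE subrr inner0r add0r.
move: H; set D := d (_ + _); set P := phi (_ + _).
set a := inner p _; set b := inner (gradd y) _; set c := inner (gradd z) (_ - _).
move: (inner (gradd z) (y - z)) => q.
move=> H1 H2 H3 H4; rewrite -(ler_pM2l t0).
have H1' : M * (D - d y - t * b) <= t * e.
  rewrite (_ : t * e = M * (t * (e / M))); last by field; rewrite gt_eqF.
  by rewrite ler_pM2l.
by have H2' := ler_wpM2l (ltW t0) H2; nra.
Qed.

(** Induction on the inner loop: a rejection only doubles the trial constant, which stays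
    positive. *)
Lemma backtracking_accepted Q V psi (delta dt : R) xk (M M' : R) y x :
  0 < M -> backtracking Q V psi delta dt xk M M' y x ->
  [/\ 0 < M', trial_points Q V psi dt xk M' y x &
      acceptance_test V psi delta xk M' y x].
Proof.
move=> M0 bt; elim: bt M0 => {M M' y x} [//|M y x M' y' x' _ _ _ IH M0].
by apply: IH; rewrite mulr_gt0.
Qed.

(** The first auxiliary problem is compared with the new iterate [x], the second with [z]. In their
    sum [M * V(x, xk)] cancels, and the acceptance test absorbs the other terms not involving
    [z]. *)
Lemma accepted_step Q d (gradd : point -> point) psi (delta dt M : R) xk y x z :
  convex_set Q -> (forall x, Q x -> is_gradient_on Q d x (gradd x)) ->
  (forall w, Q w -> convex_function Q (psi^~ w)) ->
  0 < M -> Q xk -> Q z ->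
  trial_points Q (bregman d gradd) psi dt xk M y x ->
  acceptance_test (bregman d gradd) psi delta xk M y x ->
  - psi z y <= M * (bregman d gradd z xk - bregman d gradd z x)
               + (2 * dt + delta).
Proof.
move=> Qc dg psic M0 Qk Qz [ty tx] acc.
have [[Qy _] [Qx _]] := (ty, tx).
have := inexact_prox Qc dg (psic _ Qk) M0 ty Qx.
have := inexact_prox Qc dg (psic _ Qy) M0 tx Qz.
move: acc; rewrite /acceptance_test (mulrBr M (bregman _ _ z xk)) /=.
by move: (M * _) (M * _) (M * _) (M * _) (M * _) => *; lra.
Qed.

End Prox.

(** * Telescoping along the run and the gap at the average *)

Theorem mainTheorem3 (R : realType) (n1 n2 : nat)
    (norm1 : 'rV[R]_n1 -> R) (norm2 : 'rV[R]_n2 -> R)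
    (Hnorm1 : is_norm norm1) (Hnorm2 : is_norm norm2)
    (Q1 : set 'rV[R]_n1) (Q2 : set 'rV[R]_n2)
    (Q1_nonempty : Q1 !=set0) (Q2_nonempty : Q2 !=set0)
    (Q1_convex : convex_set Q1) (Q2_convex : convex_set Q2)
    (Q1_compact : compact Q1) (Q2_compact : compact Q2)
    (f : 'rV[R]_n1 -> 'rV[R]_n2 -> R)
    (Hf : convex_concave Q1 Q2 f)
    (d : 'rV[R]_n1 * 'rV[R]_n2 -> R)
    (gradd : 'rV[R]_n1 * 'rV[R]_n2 -> 'rV[R]_n1 * 'rV[R]_n2)
    (d_differentiable :
       forall x, (Q1 `*` Q2) x -> is_gradient_on (Q1 `*` Q2) d x (gradd x))
    (d_strongly_convex :
       strongly_convex 1 (pnorm norm1 norm2) (Q1 `*` Q2) d)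
    (L delta dt eps : R)
    (L_gt0 : 0 < L) (delta_gt0 : 0 < delta) (dt_ge0 : 0 <= dt)
    (eps_gt0 : 0 < eps)
    (psi : 'rV[R]_n1 * 'rV[R]_n2 -> 'rV[R]_n1 * 'rV[R]_n2 -> R)
    (Hpsi : saddle_model (Q1 `*` Q2) f (bregman d gradd) delta L psi)
    (L0 : R) (L0_bounds : 0 < L0 <= 2 * L)
    (N : nat) (N_ge1 : (1 <= N)%N)
    (Ls : nat -> R) (xs ys : nat -> 'rV[R]_n1 * 'rV[R]_n2)
    (Hrun : adaptive_run (Q1 `*` Q2) d (bregman d gradd) psi
              delta dt eps L0 N Ls xs ys) :
  let y_avg := weighted_average Ls ys N in
  forall u v, Q1 u -> Q2 v ->
    f y_avg.1 v - f u y_avg.2 <= eps + 2 * dt + delta.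

Proof.
case: N N_ge1 Hrun => // n _ Hrun y_avg u v Qu Qv.
pose Q := Q1 `*` Q2; pose z := (u, v).
have Qc : convex_set Q := convex_setX Q1_convex Q2_convex.
have Qk : compact Q := compact_setX Q1_compact Q2_compact.
have Qz : Q z by [].
pose V := bregman d gradd.
(* The telescoped bound is proved together with the positivity and feasibility that the next
   iteration and Jensen's inequality require. *)
have run k : (k <= n.+1)%N ->
    [/\ 0 < Ls k, Q (xs k), forall i, (i < k)%N ->
      0 < (Ls i.+1)^-1 /\ Q (ys i.+1) &
    \sum_(i < k) (Ls i.+1)^-1 * - psi z (ys i.+1) <=
      V z (xs 0%N) - V z (xs k) + weight_sum Ls k * (2 * dt + delta)].
  elim: k => [_|k IH kN].
    rewrite (run_L0 Hrun) /weight_sum !big_ord0 mul0r subrr addr0; split=> //.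
      by case/andP: L0_bounds.
    by case: (run_x0 Hrun).
  have [Lk Qxk prev sumk] := IH (ltnW kN).
  have [L1 tr acc] :=
    backtracking_accepted (divr_gt0 Lk (ltr0n _ 2)) (run_step Hrun kN).
  have [[Qy _] [Qx _]] := tr.
  split=> //.
    move=> i; rewrite ltnS leq_eqVlt => /predU1P[->|]; last exact: prev.
    by rewrite invr_gt0.
  rewrite /weight_sum !big_ord_recr /= mulrDl.
  have := accepted_step Qc d_differentiable (model_convex Hpsi) L1 Qxk Qz tr acc.
  (* Division by [L^(k+1)] frees the divergences of their factor, so they telescope, and gives the
     error the weight of the iteration. *)
  rewrite -(@ler_pM2l _ (Ls k.+1)^-1) ?invr_gt0// mulrDr mulKf ?gt_eqF// => step.
  apply: (le_trans (lerD sumk step)); rewrite -/V -/(weight_sum Ls k).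
  by rewrite le_eqVlt; apply/orP; left; apply/eqP; ring.
have [_ QxN iters sumN] := run n.+1 (leqnn _).
have V_ge0 : 0 <= V z (xs n.+1).
  exact: (bregman_ge0 Qc d_strongly_convex (d_differentiable _ QxN) Qz QxN).
(* This is where stopping enters: the initial divergence costs at most [eps] per unit of weight. *)
have V0_le : V z (xs 0%N) <= eps * weight_sum Ls n.+1.
  have := run_stop Hrun; rewrite /stopping_criterion ler_pdivrMr// mulrC.
  apply: le_trans; apply: ub_le_sup; last by exists z.
  exact: bregman_bounded.
(* Jensen is applied to [f] in its first argument with [v] fixed, then to [- f] in its second with
   [u] fixed, with the same weights. *)
have [W0 _ fv] := jensen_weighted (w := fun k => (Ls k.+1)^-1)
  (p := fun k => (ys k.+1).1) Q1_convex
  (Hf.1 v Qv) (fun k kn => let: conj w0 Qy := iters k kn in conj w0 Qy.1).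
have [_ _ fu] := jensen_weighted (w := fun k => (Ls k.+1)^-1)
  (p := fun k => (ys k.+1).2) Q2_convex
  (Hf.2 u Qu) (fun k kn => let: conj w0 Qy := iters k kn in conj w0 Qy.2).
have avg1 : y_avg.1 = (weight_sum Ls n.+1)^-1 *:
    \sum_(k < n.+1) (Ls k.+1)^-1 *: (ys k.+1).1.
  by rewrite /y_avg /weighted_average /=; congr (_ *: _); exact: (big_morph fst).
have avg2 : y_avg.2 = (weight_sum Ls n.+1)^-1 *:
    \sum_(k < n.+1) (Ls k.+1)^-1 *: (ys k.+1).2.
  by rewrite /y_avg /weighted_average /=; congr (_ *: _); exact: (big_morph snd).
rewrite avg1 avg2; apply: (le_trans (lerD fv fu)).
rewrite -mulrDr -big_split /= -/(weight_sum Ls n.+1) ler_pdivrMl//.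
rewrite -/(weight_sum Ls n.+1) in W0.
(* Condition (v) of the model at the pair [z], [y^(i+1)] bounds each weighted gap. *)
apply: (@le_trans _ _ (\sum_(i < n.+1) (Ls i.+1)^-1 * - psi z (ys i.+1))).
  apply: ler_sum => i _; have [w0 Qy] := iters i (ltn_ord i).
  by rewrite -mulrDr ler_pM2l//; exact: (model_gap Hpsi Qz Qy).
by apply: (le_trans sumN); lra.
Qed.
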